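(* Let $\mathbb{K}$ be a ring with unit, $V$ a right $\mathbb{K}$-module and $U\subset V$ a non-empty subset. The data $(\pi_0,\pi_1:U^{\{1\}}\rightrightarrows U\times\mathbb{K},\,z,\,\ast)$ define a groupoid. This groupoid is a bundle of groupoids over $\mathbb{K}$, i.e., for every fixed value of $t\in\mathbb{K}$, we have a groupoid $(\pi:U_t\rightrightarrows U,z,\ast)$, where $$U_t:=\{(x,v)\mid x\in U,\ x+vt\in U\},\qquad (x',v')\ast(x,v)=(x,v'+v),$$ $$U_t\times_U U_t=\{((x',v'),(x,v))\in U_t\times U_t\mid x'=x+vt\}.$$
   Context: $\mathbb{K}$ is not assumed commutative. $U^{\{1\}}:=\{(x,v,t)\in V\times V\times\mathbb{K}\mid x\in U,\ x+vt\in U\}$. Source and target are $\pi_0,\pi_1:U^{\{1\}}\to U\times\mathbb{K}$, $\pi_0(x,v,t)=(x,t)$, $\pi_1(x,v,t)=(x+vt,t)$; the unit section is $z:U\times\mathbb{K}\to U^{\{1\}}$, $z(x,t)=(x,0,t)$. For $a=(x,v,t),a'=(x',v',t')\in U^{\{1\}}$ with $\pi_1(a)=\pi_0(a')$ (so $t'=t$, $x'=x+vt$), $a'\ast a:=(x,v'+v,t)$. A groupoid is a small category all of whose morphisms are invertible; objects here are $U\times\mathbb{K}$ and morphisms $U^{\{1\}}$. On $U_t$ the source and target maps are $(x,v)\mapsto x$ and $(x,v)\mapsto x+vt$, the unit section is $x\mapsto(x,0)$, and $U_t\times_UU_t$ is the set of composable pairs. *)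

(* Defs.v *)
From mathcomp Require Import all_boot all_algebra.
From mathcomp Require Import all_classical.

Set Implicit Arguments.
Unset Strict Implicit.
Unset Printing Implicit Defensive.

Import GRing.Theory.
Local Open Scope classical_set_scope.
Local Open Scope ring_scope.

(* A right K-module is a left module over the converse ring K^c; [rscale v t]
   is the product written vt on paper, and [rscalerA] is v(st) = (vs)t. *)
Definition rscale (K : pzRingType) (V : lmodType K^c) (v : V) (t : K) : V :=
  (t : K^c) *: v.

Lemma rscalerA (K : pzRingType) (V : lmodType K^c) (v : V) (s t : K) :
  rscale v (s * t) = rscale (rscale v s) t.
Proof. by rewrite /rscale scalerA. Qed.

(* The objects and morphisms are subsets of ambient types, and the structure
   maps are functions on those types. Only their values on objects, on
   morphisms and on composable pairs matter; that these values again lie in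
   the prescribed subsets is part of [is_category]. *)
Record cat_data := CatData {
  Obj : Type;
  Mor : Type;
  obj : set Obj;
  mor : set Mor;
  src : Mor -> Obj;
  tgt : Mor -> Obj;
  idm : Obj -> Mor;
  comp : Mor -> Mor -> Mor (* [comp a' a] is a' after a *)
}.

Definition composable (G : cat_data) : set (Mor G * Mor G) :=
  [set p | [/\ mor p.1, mor p.2 & tgt p.2 = src p.1]].

Record is_category (G : cat_data) : Prop := IsCategory {
  src_obj : forall a : Mor G, mor a -> obj (src a);
  tgt_obj : forall a : Mor G, mor a -> obj (tgt a);
  idm_mor : forall x : Obj G, obj x -> mor (idm x);
  comp_mor : forall a' a : Mor G, composable (a', a) -> mor (comp a' a);
  src_idm : forall x : Obj G, obj x -> src (idm x) = x;
  tgt_idm : forall x : Obj G, obj x -> tgt (idm x) = x;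
  src_comp : forall a' a : Mor G, composable (a', a) -> src (comp a' a) = src a;
  tgt_comp : forall a' a : Mor G, composable (a', a) -> tgt (comp a' a) = tgt a';
  comp_idm_r : forall a : Mor G, mor a -> comp a (idm (src a)) = a;
  comp_idm_l : forall a : Mor G, mor a -> comp (idm (tgt a)) a = a;
  compA : forall a'' a' a : Mor G, composable (a'', a') -> composable (a', a) ->
    comp a'' (comp a' a) = comp (comp a'' a') a
}.

Definition invertible (G : cat_data) (a : Mor G) : Prop :=
  exists b : Mor G, [/\ composable (b, a), composable (a, b),
    comp b a = idm (src a) & comp a b = idm (tgt a)].

Definition is_groupoid (G : cat_data) : Prop :=
  is_category G /\ forall a : Mor G, mor a -> invertible a.

Definition fibre (B : Type) (G : cat_data) (pO : Obj G -> B) (pM : Mor G -> B)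
    (b : B) : cat_data :=
  CatData (@obj G `&` pO @^-1` [set b]) (@mor G `&` pM @^-1` [set b])
    (@src G) (@tgt G) (@idm G) (@comp G).

Record is_groupoid_bundle (B : Type) (G : cat_data)
    (pO : Obj G -> B) (pM : Mor G -> B) : Prop := IsGroupoidBundle {
  bundle_groupoid : is_groupoid G;
  bundle_src : forall a : Mor G, mor a -> pO (src a) = pM a;
  bundle_tgt : forall a : Mor G, mor a -> pO (tgt a) = pM a;
  bundle_fibre : forall b : B, is_groupoid (fibre pO pM b)
}.

Record is_iso (G H : cat_data) (fO : Obj G -> Obj H) (fM : Mor G -> Mor H) :
    Prop := IsIso {
  iso_obj : set_bij (@obj G) (@obj H) fO;
  iso_mor : set_bij (@mor G) (@mor H) fM;
  iso_src : forall a : Mor G, mor a -> src (fM a) = fO (src a);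
  iso_tgt : forall a : Mor G, mor a -> tgt (fM a) = fO (tgt a);
  iso_idm : forall x : Obj G, obj x -> fM (idm x) = idm (fO x);
  iso_comp : forall a' a : Mor G, composable (a', a) ->
    fM (comp a' a) = comp (fM a') (fM a)
}.

Section TangentGroupoid.
Variables (K : pzRingType) (V : lmodType K^c) (U : set V).

Definition U1 : set (V * V * K) :=
  [set a | let: (x, v, t) := a in U x /\ U (x + rscale v t)].

Definition pi0 (a : V * V * K) : V * K := let: (x, v, t) := a in (x, t).

Definition pi1 (a : V * V * K) : V * K :=
  let: (x, v, t) := a in (x + rscale v t, t).

Definition zsec (p : V * K) : V * V * K := let: (x, t) := p in (x, 0, t).

Definition star (a' a : V * V * K) : V * V * K :=
  let: (x', v', t') := a' in let: (x, v, t) := a in (x, v' + v, t).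

Definition tangent_groupoid : cat_data :=
  CatData (U `*` [set: K]) U1 pi0 pi1 zsec star.

Definition Ut (t : K) : set (V * V) :=
  [set a | let: (x, v) := a in U x /\ U (x + rscale v t)].

Definition src_t (a : V * V) : V := let: (x, v) := a in x.

Definition tgt_t (t : K) (a : V * V) : V := let: (x, v) := a in x + rscale v t.

Definition zsec_t (x : V) : V * V := (x, 0).

Definition star_t (a' a : V * V) : V * V :=
  let: (x', v') := a' in let: (x, v) := a in (x, v' + v).

Definition tangent_groupoid_at (t : K) : cat_data :=
  CatData U (Ut t) src_t (tgt_t t) zsec_t star_t.

End TangentGroupoid.

(* Main.v *)
(* The arrow (x, v, t) goes from x to x + vt over the fixed parameter t, and
   composition adds the displacements v. Every groupoid axiom then comes from
   the additive group V together with (v' + v)t = v't + vt; the inverse of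
   (x, v, t) is (x + vt, -v, t). Source and target preserve t, so the groupoid
   splits into its fibres over K. *)
Require Import Defs.
From mathcomp Require Import all_boot all_algebra.
From mathcomp Require Import all_classical.

Import GRing.Theory.
Local Open Scope classical_set_scope.
Local Open Scope ring_scope.

(** Since [src] and [tgt] preserve the label in [B], the identities, composites and inverses formed
    from data over [b] stay over [b]; the equational axioms are inherited from [G]. *)
Lemma fibre_is_groupoid (B : Type) (G : cat_data)
    (pO : Obj G -> B) (pM : Mor G -> B) (b : B) :
  is_groupoid G ->
  (forall a, mor a -> pO (src a) = pM a) ->
  (forall a, mor a -> pO (tgt a) = pM a) ->
  is_groupoid (fibre pO pM b).
Proof.
move=> [[So To Im Cm Si Ti Sc Tc Cr Cl CA] Ginv] pS pT.
have compW (a' a : Mor G) :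
    @composable (fibre pO pM b) (a', a) -> @composable G (a', a).
  by move=> [[ma' _] [ma _] e].
split; last first.
  move=> a [ma pa].
  have [a1 [ba ab ea ea1]] := Ginv a ma.
  have [/= ma1 _ e] := ba.
  (* The inverse starts where [a] ends, so its label is that of the target of [a], which is [b]. *)
  have pa1 : pM a1 = b by rewrite -pS // -e pT.
  have [/= _ _ e'] := ab.
  by exists a1; split=> //; split.
split=> /=.
- by move=> a [ma pa]; split; [exact: So | rewrite /= pS].
- by move=> a [ma pa]; split; [exact: To | rewrite /= pT].
- move=> x [ox px]; have mi := Im x ox.
  by split=> //=; rewrite -pS // Si.
- move=> a' a c; have c' := compW _ _ c.
  have mc := Cm _ _ c'; split=> //=.
  (* The label of a composite is read off at its source, which is the source of [a]. *)
  by rewrite -pS // Sc // pS; case: c => _ [].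
- by move=> x [ox _]; exact: Si.
- by move=> x [ox _]; exact: Ti.
- by move=> a' a /compW; exact: Sc.
- by move=> a' a /compW; exact: Tc.
- by move=> a [ma _]; exact: Cr.
- by move=> a [ma _]; exact: Cl.
- by move=> a'' a' a /compW c1 /compW; exact: CA.
Qed.

Section TangentGroupoidTheory.
Variables (K : pzRingType) (V : lmodType K^c) (U : set V).

Lemma rscale0 (t : K) : rscale (0 : V) t = 0.
Proof. exact: scaler0. Qed.

(** The vector sits on the left on paper but on the right of [*:] over [K^c], hence [scalerDr]. *)
Lemma rscaleDl (v w : V) (t : K) : rscale (v + w) t = rscale v t + rscale w t.
Proof. exact: scalerDr. Qed.

Lemma rscaleN (v : V) (t : K) : rscale (- v) t = - rscale v t.
Proof. exact: scalerN. Qed.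

Lemma tangent_groupoid_at_is_groupoid (t : K) :
  is_groupoid (tangent_groupoid_at U t).
Proof.
split; last first.
  move=> [x v] [Ux Uy]; exists (x + rscale v t, - v).
  (* The reversed arrow leads back to x, so it is a morphism because x lies in [U]. *)
  have Uz : U (x + rscale v t + rscale (- v) t) by rewrite rscaleN addrK.
  by split=> /=; [split | split=> //=; rewrite rscaleN addrK
                 | rewrite addNr | rewrite addrN].
split=> /=.
- by move=> [x v] [].
- by move=> [x v] [].
- by move=> x Ux; split=> //; rewrite rscale0 addr0.
- move=> [x' v'] [x v] [/= [_ U'] [Ux _] e]; split=> //.
  (* x + (v' + v)t = (x + vt) + v't = x' + v't: the composite ends where the second arrow ends. *)
  by rewrite rscaleDl [rscale v' t + _]addrC addrA e.
- by [].
- by move=> x _; rewrite rscale0 addr0.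
- by move=> [x' v'] [x v].
- move=> [x' v'] [x v] [/= _ _ e].
  by rewrite rscaleDl [rscale v' t + _]addrC addrA e.
- by move=> [x v] _ /=; rewrite addr0.
- by move=> [x v] _ /=; rewrite add0r.
- by move=> [x2 v2] [x1 v1] [x v] _ _ /=; rewrite addrA.
Qed.

Lemma tangent_groupoid_is_groupoid : is_groupoid (tangent_groupoid U).
Proof.
split; last first.
  move=> [[x v] t] [Ux Uy]; exists (x + rscale v t, - v, t).
  have Uz : U (x + rscale v t + rscale (- v) t) by rewrite rscaleN addrK.
  by split=> /=; [split | split=> //=; rewrite rscaleN addrK
                 | rewrite addNr | rewrite addrN].
split=> /=.
- by move=> [[x v] t] [].
- by move=> [[x v] t] [].
- by move=> [x t] [Ux _]; split=> //; rewrite rscale0 addr0.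
- move=> [[x' v'] t'] [[x v] t] [/= [_ U'] [Ux _] [e et]]; split=> //.
  (* [star] keeps the parameter of the first arrow; composability makes it equal to t' through
     [et]. *)
  by rewrite rscaleDl [rscale v' t + _]addrC addrA e et.
- by move=> [x t].
- by move=> [x t] _ /=; rewrite rscale0 addr0.
- by move=> [[x' v'] t'] [[x v] t].
- move=> [[x' v'] t'] [[x v] t] [/= _ _ [e et]].
  by rewrite rscaleDl [rscale v' t + _]addrC addrA e et.
- by move=> [[x v] t] _ /=; rewrite addr0.
- by move=> [[x v] t] _ /=; rewrite add0r.
- by move=> [[x2 v2] t2] [[x1 v1] t1] [[x v] t] _ _ /=; rewrite addrA.
Qed.

Lemma tangent_groupoid_is_groupoid_bundle :
  @is_groupoid_bundle K (tangent_groupoid U)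
    (fun p : V * K => p.2) (fun a : V * V * K => a.2).
Proof.
have S (a : V * V * K) : U1 U a -> (pi0 a).2 = a.2 by case: a => [[]].
have T (a : V * V * K) : U1 U a -> (pi1 a).2 = a.2 by case: a => [[]].
split=> // [|t]; first exact: tangent_groupoid_is_groupoid.
by apply: fibre_is_groupoid => //; exact: tangent_groupoid_is_groupoid.
Qed.

Lemma composable_tangent_groupoid_at (t : K) :
  @composable (tangent_groupoid_at U t) =
    [set p : (V * V) * (V * V) | let: ((x', v'), (x, v)) := p in
       [/\ Ut U t (x', v'), Ut U t (x, v) & x' = x + rscale v t]].
Proof. by apply/seteqP; split=> -[[x' v'] [x v]] [/= m' m e]; split. Qed.

(** This identifies the groupoid on pairs with the actual fibre over t, whose elements still carry
    the parameter. Appending t is inverse to forgetting the last coordinate, which is constantly t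
    on the fibre. *)
Lemma tangent_groupoid_at_iso_fibre (t : K) :
  @is_iso (tangent_groupoid_at U t)
    (@fibre K (tangent_groupoid U)
       (fun p : V * K => p.2) (fun a : V * V * K => a.2) t)
    (fun x : V => (x, t)) (fun a : V * V => (a.1, a.2, t)).
Proof.
split=> /=.
- split=> [x Ux|x y _ _ [] //|[x s] [[Ux _] /= <-]]; first by split.
  by exists x.
- split=> [[x v] Uxv|[x v] [y w] _ _ [-> ->] //|[[x v] s] [Uxv /= <-]].
    by split.
  by exists (x, v).
- by move=> [x v].
- by move=> [x v].
- by [].
- by move=> [x' v'] [x v].
Qed.

End TangentGroupoidTheory.

Theorem theorem2p5 (K : pzRingType) (V : lmodType K^c) (U : set V)
    (hU : U !=set0) :
  is_groupoid (tangent_groupoid U) /\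
  @is_groupoid_bundle K (tangent_groupoid U)
    (fun p : V * K => p.2) (fun a : V * V * K => a.2) /\
  (forall t : K,
    [/\ is_groupoid (tangent_groupoid_at U t),
        @composable (tangent_groupoid_at U t) =
          [set p : (V * V) * (V * V) | let: ((x', v'), (x, v)) := p in
             [/\ Ut U t (x', v'), Ut U t (x, v) & x' = x + rscale v t]]
      & @is_iso (tangent_groupoid_at U t)
          (@fibre K (tangent_groupoid U)
             (fun p : V * K => p.2) (fun a : V * V * K => a.2) t)
          (fun x : V => (x, t)) (fun a : V * V => (a.1, a.2, t))]).
Proof.
split; first exact: tangent_groupoid_is_groupoid.
split; first exact: tangent_groupoid_is_groupoid_bundle.
move=> t; split.
- exact: tangent_groupoid_at_is_groupoid.
- exact: composable_tangent_groupoid_at.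
- exact: tangent_groupoid_at_iso_fibre.
Qed.
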